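(* Let $G=(V,E)$ be a loop-free multigraph and, for each $v\in V$, let $\varphi_v:\mathbb{Z}_+\to\mathbb{R}$ be a discrete linear function $\varphi_v(z)=a_vz+b_v$ with $a_v,b_v\in\mathbb{R}$. Then any vertex order in which the vertices appear in non-increasing order of the slopes $a_v$ minimizes $\sum_{v\in V}\varphi_v(\overleftarrow{d}(v))$ over all vertex orders of $G$.
   Context: A vertex order is a linear ordering $\sigma=(\sigma_1,\dots,\sigma_n)$ of $V$; the left-degree $\overleftarrow{d}(v)$ of $v=\sigma_i$ is the number of edges (with multiplicity) joining $v$ to $\{\sigma_1,\dots,\sigma_{i-1}\}$. *)

(* Defs.v *)
From mathcomp Require Import all_boot all_order all_algebra.
From mathcomp Require Import reals.

Set Implicit Arguments.
Unset Strict Implicit.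
Unset Printing Implicit Defensive.

(* Edges form a type of their own, so parallel edges are distinct elements with
   the same set of ends; an edge with a single end is a loop. *)
Record multigraph := Multigraph {
  vertex : finType;
  edge : finType;
  ends : edge -> {set vertex};
  ends_card : forall e : edge, 1 <= #|ends e| <= 2
}.

Definition loop_free (G : multigraph) : Prop :=
  forall e : edge G, #|ends e| = 2.

Definition vertex_order (G : multigraph) (s : seq (vertex G)) : Prop :=
  uniq s /\ (forall v : vertex G, v \in s).

Definition left_degree (G : multigraph) (s : seq (vertex G)) (v : vertex G) : nat :=
  #|[set e : edge G |
      [exists u, (u \in take (index v s) s) && (ends e == [set u; v])]]|.

Local Open Scope ring_scope.

Definition order_cost (R : realType) (G : multigraph)
    (phi : vertex G -> nat -> R) (s : seq (vertex G)) : R :=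
  \sum_(v : vertex G) phi v (left_degree s v).

(* Main.v *)
Require Import Defs.
From mathcomp Require Import all_boot all_order all_algebra.
From mathcomp Require Import reals.

(** With linear costs, each edge contributes the slope of whichever of its two
    ends comes last, so the total is a constant plus a sum over edges.  An order
    with non-increasing slopes puts the end of smaller slope last on every edge
    simultaneously, hence minimizes each summand. *)

Import Order.TTheory GRing.Theory Num.Theory.

Local Open Scope ring_scope.

(** The condition that [left_degree] counts, isolated as a relation between edges and vertices so
    that it can be summed over either one. *)
Definition last_end {G : multigraph} (s : seq (vertex G)) (e : edge G)
    (v : vertex G) : bool :=
  [exists u, (u \in take (index v s) s) && (ends e == [set u; v])].

Lemma last_endE {G : multigraph} {s : seq (vertex G)} {e : edge G}
    {x y : vertex G} :
  vertex_order s -> ends e = [set x; y] -> (index x s < index y s)%N ->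
  last_end s e =1 pred1 y.
Proof.
move=> [_ s_all] ends_e lt_xy v; rewrite /last_end ends_e /=.
apply/existsP/eqP => [[u] | ->]; last by exists x; rewrite in_take ?lt_xy /=.
rewrite in_take // => /andP[lt_uv /eqP eq_uv].
(* If [v] were [x], then [u] would have to be [y], which does not precede [x]. *)
have /set2P[eq_vx | //] : v \in [set x; y] by rewrite eq_uv set22.
have /set2P[eq_yu | //] : y \in [set u; v] by rewrite -eq_uv set22.
by move: lt_uv; rewrite -eq_yu eq_vx ltnNge (ltnW lt_xy).
Qed.

Lemma sum_last_end {V : nmodType} {G : multigraph} (a : vertex G -> V)
    {s : seq (vertex G)} {e : edge G} {x y : vertex G} :
  vertex_order s -> ends e = [set x; y] -> (index x s < index y s)%N ->
  \sum_(v | last_end s e v) a v = a y.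
Proof.
move=> hs ends_e lt_xy.
by rewrite (eq_bigl _ _ (last_endE hs ends_e lt_xy)) big_pred1_eq.
Qed.

Lemma order_cost_linear {R : realType} {G : multigraph} {a b : vertex G -> R}
    {phi : vertex G -> nat -> R} (s : seq (vertex G)) :
  (forall v z, phi v z = a v * z%:R + b v) ->
  order_cost phi s =
    \sum_(e : edge G) \sum_(v | last_end s e v) a v + \sum_v b v.
Proof.
move=> hphi; rewrite /order_cost (eq_bigr _ (fun v _ => hphi v _)) big_split /=.
(* Double counting: after the exchange, the constant [a v] is summed over the edges with
   [last_end s e v], and there are [left_degree s v] of these. *)
congr (_ + _); rewrite (exchange_big_dep predT) //=; apply: eq_bigr => v _.
by rewrite sumr_const mulr_natr /left_degree cardsE.
Qed.

Lemma ends_ordered {G : multigraph} {s : seq (vertex G)} {e : edge G} :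
  vertex_order s -> #|ends e| = 2 ->
  exists x y, ends e = [set x; y] /\ (index x s < index y s)%N.
Proof.
move=> [_ s_all] /eqP/cards2P[x [y [neq_xy ends_e]]].
have [lt_xy | lt_yx | eq_xy] := ltngtP (index x s) (index y s).
- by exists x, y.
- by exists y, x; rewrite setUC.
- by move: neq_xy; rewrite (index_inj x (s_all x) (s_all y) eq_xy) eqxx.
Qed.

Theorem theorem5 (R : realType) (G : multigraph) (hG : loop_free G)
    (a b : vertex G -> R) (phi : vertex G -> nat -> R)
    (hphi : forall (v : vertex G) (z : nat), phi v z = a v * z%:R + b v)
    (s : seq (vertex G)) (hs : vertex_order s)
    (hsorted : sorted (fun u v : vertex G => a v <= a u) s) :
  forall t : seq (vertex G), vertex_order t ->
    order_cost phi s <= order_cost phi t.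
Proof.
move=> t ht; rewrite !(order_cost_linear _ hphi) lerD2r.
apply: ler_sum => e _.
have [x [y [ends_s lt_s]]] := ends_ordered hs (hG e).
have [u [w [ends_t lt_t]]] := ends_ordered ht (hG e).
rewrite (sum_last_end _ hs ends_s lt_s).
rewrite (sum_last_end _ ht ends_t lt_t).
(* The last end [w] in [t] is [x] or [y]. If it is [y], the two summands agree; if it is [x], then
   [a y <= a x] because [x] precedes [y] in the sorted order [s]. *)
have: w \in [set x; y] by rewrite -ends_s ends_t set22.
case/set2P => -> //.
have a_trans : transitive (fun u v : vertex G => a v <= a u).
  by move=> v1 v2 v3 le12 le13; apply: le_trans le13 le12.
by apply: (sorted_ltn_index a_trans hsorted); rewrite ?hs.2.
Qed.
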